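(* For all $(a,b,c)\in\mathbb{C}^3$: (1) the sequence $\bigl(\{\cdot,\cdot\}^{[a,b,c]}_n\bigr)_{n\ge 0}$ is a formal deformation of $\widetilde J$; (2) $\{\widetilde J_{k,p},\widetilde J_{\ell,q}\}^{[a,b,c]}_n\subset \widetilde J_{k+\ell+2n,\,p+q}$ for all $k,\ell\in 2\mathbb{Z}$, $p,q\in\mathbb{Z}_{\ge0}$, $n\in\mathbb{Z}_{\ge0}$; (3) the subalgebra $\mathcal M_*$ is stable under every $\{\cdot,\cdot\}^{[a,b,c]}_n$, and for $f,g\in\mathcal M_*$ one has $\{f,g\}^{[a,b,c]}_n=\mathrm{SRC}_n(f,g)$ for all $n$.
   Context: Let $\widetilde J=\mathbb{C}[E_4,E_6,A,B]$ be the polynomial algebra in four algebraically independent variables, bigraded by weight and index, where $E_4$ has weight $4$ and index $0$, $E_6$ has weight $6$ and index $0$, $A$ has weight $-2$ and index $1$, $B$ has weight $0$ and index $1$; $\widetilde J_{k,p}$ denotes the homogeneous component of weight $k$ and index $p$ (elements of some $\widetilde J_{k,p}$ are called homogeneous). (This is the algebra of weak Jacobi forms of even weight on $\mathrm{SL}(2,\mathbb{Z})$, with $E_4,E_6$ the Eisenstein series and $A,B$ the standard generators of weight $-2$ and $0$ and index 1.) Let $\mathcal M_*=\mathbb{C}[E_4,E_6]$ (the index-$0$ part, the algebra of modular forms), with $\mathcal M_k$ its weight-$k$ part. The Serre derivation $S$ of $\mathcal M_*$ is the derivation with $S(E_4)=-\tfrac13E_6$, $S(E_6)=-\tfrac12E_4^2$.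 The Serre–Rankin–Cohen brackets are $\mathrm{SRC}_n(f,g)=\sum_{i=0}^n(-1)^i\binom{k+n-1}{n-i}\binom{\ell+n-1}{i}S^i(f)S^{n-i}(g)$ for $f\in\mathcal M_k,g\in\mathcal M_\ell$, extended bilinearly. For $(a,b)\in\mathbb{C}^2$, $S_{a,b}$ is the derivation of $\widetilde J$ with $S_{a,b}(E_4)=-\tfrac13E_6$, $S_{a,b}(E_6)=-\tfrac12E_4^2$, $S_{a,b}(A)=aB$, $S_{a,b}(B)=bE_4A$. For $c\in\mathbb{C}$ and $n\ge0$, $\{\cdot,\cdot\}^{[a,b,c]}_n$ is the bilinear map $\widetilde J\times\widetilde J\to\widetilde J$ defined on homogeneous $f\in\widetilde J_{k,p}$, $g\in\widetilde J_{\ell,q}$ by $\{f,g\}^{[a,b,c]}_n=\sum_{r=0}^n(-1)^r\binom{k+cp+n-1}{n-r}\binom{\ell+cq+n-1}{r}S_{a,b}^r(f)\,S_{a,b}^{n-r}(g)$, where $\binom{x}{m}=x(x-1)\cdots(x-m+1)/m!$ for complex $x$. A formal deformation of a commutative $\mathbb{C}$-algebra $R$ is a sequence $(\mu_j)_{j\ge0}$ of bilinear maps $R\times R\to R$ with $\mu_0$ the product of $R$ such that for all $n\ge0$ and $f,g,h\in R$: $\sum_{r=0}^n\mu_{n-r}(\mu_r(f,g),h)=\sum_{r=0}^n\mu_{n-r}(f,\mu_r(g,h))$ (i.e. $f\star g=\sum_j\mu_j(f,g)\hbar^j$ is an associative product on $R[[\hbar]]$). *)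

(* Defs.v *)
From HB Require Import structures.
From mathcomp Require Import all_boot all_order all_algebra.
Set Implicit Arguments. Unset Strict Implicit. Unset Printing Implicit Defensive.
Import Order.TTheory GRing.Theory Num.Theory.
Local Open Scope ring_scope.

Section Defs.
Variable F : numClosedFieldType.

(* polynomial algebra C[E4,E6,A,B] as nested univariate polynomials:
   innermost variable E4, then E6, then A, outermost B. *)
Definition P1 := {poly F}.
Definition P2 := {poly {poly F}}.      (* C[E4,E6] = M_* *)
Definition P3 := {poly {poly {poly F}}}.
Definition J := {poly {poly {poly {poly F}}}}.

Definition cst (x : F) : J := x%:P%:P%:P%:P.
Definition E4 : J := ('X : {poly F})%:P%:P%:P.
Definition E6 : J := ('X : {poly {poly F}})%:P%:P.
Definition Av : J := ('X : {poly {poly {poly F}}})%:P.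
Definition Bv : J := 'X.

Definition coefJ (f : J) (i j k l : nat) : F := f`_l`_k`_j`_i.
Definition monJ (i j k l : nat) : J := E4 ^+ i * E6 ^+ j * Av ^+ k * Bv ^+ l.
Definition wtJ (i j k : nat) : int := (4 * i + 6 * j)%N%:Z - (2 * k)%N%:Z.
Definition idxJ (k l : nat) : nat := (k + l)%N.

Definition homJ (w : int) (p : nat) (f : J) : Prop :=
  forall i j k l, coefJ f i j k l != 0 -> wtJ i j k = w /\ idxJ k l = p.

Definition monsumJ (f : J) (G : nat -> nat -> nat -> nat -> J) : J :=
  \sum_(l < size f) \sum_(k < size f`_l) \sum_(j < size f`_l`_k)
    \sum_(i < size f`_l`_k`_j) cst (coefJ f i j k l) * G i j k l.

Definition dB (f : J) : J := f^`().
Definition dA (f : J) : J := map_poly (fun p : P3 => p^`()) f.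
Definition dE6 (f : J) : J := map_poly (map_poly (fun p : P2 => p^`())) f.
Definition dE4 (f : J) : J :=
  map_poly (map_poly (map_poly (fun p : P1 => p^`()))) f.

(* the derivation S_{a,b}: the unique derivation with the prescribed
   values on the generators, written via the chain rule *)
Definition Sab (a b : F) (f : J) : J :=
  dE4 f * (cst (- 3%:R^-1) * E6) + dE6 f * (cst (- 2%:R^-1) * E4 ^+ 2)
  + dA f * (cst a * Bv) + dB f * (cst b * E4 * Av).

Definition gbinom (x : F) (m : nat) : F :=
  (\prod_(i < m) (x - i%:R)) / (m`!)%:R.

(* the formula for homogeneous f in J_{k,p}, g in J_{l,q} *)
Definition brh (a b c : F) (n : nat) (k : int) (p : nat) (f : J)
    (l : int) (q : nat) (g : J) : J :=
  \sum_(r < n.+1)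
    cst ((-1) ^+ r * gbinom (k%:~R + c * p%:R + n%:R - 1) (n - r)
                   * gbinom (l%:~R + c * q%:R + n%:R - 1) r)
    * (iter r (Sab a b) f * iter (n - r) (Sab a b) g).

(* the bilinear extension (monomials are homogeneous) *)
Definition bracket (a b c : F) (n : nat) (f g : J) : J :=
  monsumJ f (fun i j k l => monsumJ g (fun i' j' k' l' =>
    brh a b c n (wtJ i j k) (idxJ k l) (monJ i j k l)
                (wtJ i' j' k') (idxJ k' l') (monJ i' j' k' l'))).

Definition formal_deformation (mu : nat -> J -> J -> J) : Prop :=
  [/\ (forall j x f f' g, mu j (cst x * f + f') g = cst x * mu j f g + mu j f' g),
      (forall j x f g g', mu j f (cst x * g + g') = cst x * mu j f g + mu j f g'),
      (forall f g, mu 0%N f g = f * g) &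
      (forall n f g h, \sum_(r < n.+1) mu (n - r)%N (mu r f g) h
                      = \sum_(r < n.+1) mu (n - r)%N f (mu r g h))].

(* modular forms M_* = C[E4,E6]: inner variable E4, outer E6 *)
Definition cstM (x : F) : P2 := x%:P%:P.
Definition E4M : P2 := ('X : {poly F})%:P.
Definition E6M : P2 := 'X.
Definition coefM (f : P2) (i j : nat) : F := f`_j`_i.
Definition monM (i j : nat) : P2 := E4M ^+ i * E6M ^+ j.
Definition wtM (i j : nat) : nat := (4 * i + 6 * j)%N.
Definition monsumM (f : P2) (G : nat -> nat -> P2) : P2 :=
  \sum_(j < size f) \sum_(i < size f`_j) cstM (coefM f i j) * G i j.

Definition SerreM (f : P2) : P2 :=
  map_poly (fun p : P1 => p^`()) f * (cstM (- 3%:R^-1) * E6M)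
  + f^`() * (cstM (- 2%:R^-1) * E4M ^+ 2).

Definition SRCh (n k l : nat) (f g : P2) : P2 :=
  \sum_(r < n.+1)
    cstM ((-1) ^+ r * gbinom (k%:R + n%:R - 1) (n - r)
                   * gbinom (l%:R + n%:R - 1) r)
    * (iter r SerreM f * iter (n - r) SerreM g).

Definition SRC (n : nat) (f g : P2) : P2 :=
  monsumM f (fun i j => monsumM g (fun i' j' =>
    SRCh n (wtM i j) (wtM i' j') (monM i j) (monM i' j'))).

Definition embM (m : P2) : J := m%:P%:P.
Definition inM (f : J) : Prop := exists m, f = embM m.

End Defs.

(* Main.v *)
(** The brackets are transvectants. If [D] raises the weight by 2, attach to
    [f] of weight [k] the function [y^-k f(x/y)] of two variables, where [D] is
    differentiation in [z = x/y]. The Rankin-Cohen bracket of [f] and [g] is then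
    the [n]-th coefficient of the Moyal product of the attached functions, and
    the Moyal product is associative because [d/dx] and [d/dy] are commuting
    derivations. Setting [y = 1] and recording the weight separately, [d/dx]
    becomes the derivation [d] extending [D] to the polynomials in [z] by
    [d z = 1], and [d/dy] becomes [- k - z d]; both raise the weight by 1.
    Everything here is valid for arbitrary constant weights, in particular for
    [k + c p]. *)
Require Import Defs.
From HB Require Import structures.
From mathcomp Require Import all_boot all_order all_algebra.
From mathcomp Require Import ring zify.
Set Implicit Arguments. Unset Strict Implicit. Unset Printing Implicit Defensive.
Import Order.TTheory GRing.Theory Num.Theory.
Local Open Scope ring_scope.

(** Pascal's rule. With both indices as arguments of [a], the right-hand side separates the two
    places where one more operator can act; this is how it enters [moyal3S] and [moyalE]. *)
Lemma pascal_sum (V : nmodType) (a : nat -> nat -> V) n :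
  \sum_(r < n.+2) a r (n.+1 - r)%N *+ 'C(n.+1, r)
  = \sum_(r < n.+1) (a r.+1 (n - r)%N + a r (n - r).+1) *+ 'C(n, r).
Proof.
under [RHS]eq_bigr do rewrite mulrnDl.
rewrite big_split /= big_ord_recl [X in _ = _ + X]big_ord_recl /= !bin0 !subn0.
rewrite addrCA; congr (_ + _).
transitivity (\sum_(r < n.+1) (a r.+1 (n - r)%N *+ 'C(n, r)
                              + a r.+1 (n - r)%N *+ 'C(n, r.+1))).
  by apply: eq_bigr => i _; rewrite /bump add1n binS subSS mulrnDr addrC.
rewrite big_split /=; congr (_ + _).
rewrite big_ord_recr /= bin_small // mulr0n addr0.
by apply: eq_bigr => i _; rewrite /bump add1n subnSK.
Qed.

(** * Derivations of a commutative ring and their coefficientwise extension to polynomials *)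

Section Derivations.

Definition derivation (R : comNzRingType) (D : R -> R) :=
  (forall x y, D (x + y) = D x + D y)
  /\ (forall x y, D (x * y) = D x * y + x * D y).

Variables (R : comNzRingType) (D : R -> R).
Hypothesis der : derivation D.

Lemma derD x y : D (x + y) = D x + D y. Proof. exact: der.1. Qed.

Lemma derM x y : D (x * y) = D x * y + x * D y. Proof. exact: der.2. Qed.

Lemma der0 : D 0 = 0.
Proof. by apply: (addrI (D 0)); rewrite -derD !addr0. Qed.

Lemma derN x : D (- x) = - D x.
Proof. by apply: (addrI (D x)); rewrite -derD !subrr der0. Qed.

Lemma derB x y : D (x - y) = D x - D y.
Proof. by rewrite derD derN. Qed.

Lemma derMn x n : D (x *+ n) = D x *+ n.
Proof. by elim: n => [|n IHn]; rewrite ?mulr0n ?der0 // !mulrSr derD IHn. Qed.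

Lemma der_sum I (s : seq I) (P : pred I) (E : I -> R) :
  D (\sum_(i <- s | P i) E i) = \sum_(i <- s | P i) D (E i).
Proof. exact: (big_morph D derD der0). Qed.

Lemma der1 : D 1 = 0.
Proof.
by apply: (addrI (D 1)); rewrite addr0 -{3}[1]mulr1 derM mulr1 mul1r.
Qed.

Lemma derivation_mulr u : derivation (fun x => D x * u).
Proof. by split=> x y; rewrite (derD, derM); ring. Qed.

Lemma derivation_map_poly : derivation (map_poly D).
Proof.
split=> p q; apply/polyP=> i.
  by rewrite coefD !coef_map_id0 ?der0 // coefD derD.
rewrite coefD !coefM coef_map_id0 ?der0 // coefM der_sum -big_split /=.
by apply: eq_bigr => j _; rewrite !coef_map_id0 ?der0 // derM.
Qed.

Lemma map_poly_derC x : map_poly D x%:P = (D x)%:P.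
Proof.
apply/polyP=> i; rewrite coef_map_id0 ?der0 // !coefC.
by case: ifP => // _; rewrite der0.
Qed.

Lemma map_poly_derX : map_poly D 'X = 0.
Proof.
apply/polyP=> i; rewrite coef_map_id0 ?der0 // coefX coef0.
by case: (i == 1)%N; rewrite ?der0 ?der1.
Qed.

End Derivations.

Lemma derivation_add (R : comNzRingType) (D D' : R -> R) :
  derivation D -> derivation D' -> derivation (fun x => D x + D' x).
Proof.
move=> dD dD'; split=> x y; first by rewrite (derD dD) (derD dD'); ring.
by rewrite (derM dD) (derM dD'); ring.
Qed.

Lemma derivation_deriv (R : comNzRingType) :
  derivation (fun p : {poly R} => p^`()).
Proof. by split=> p q; rewrite (derivD, derivM). Qed.

(** * The Moyal product in weighted form, and its associativity *)

Section Moyal.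

Variables (F A : comNzRingType) (iota : {rmorphism F -> A}).
Variables (d e : A -> A) (z : A).
Hypothesis der_d : derivation d.
Hypothesis dC : forall k, d (iota k) = 0.
Hypothesis dz : d z = 1.
Hypothesis der_e : derivation e.
Hypothesis eC : forall k, e (iota k) = 0.
Hypothesis ez : e z = 1.
Hypothesis ed : forall x, e (d x) = d (e x).

Implicit Types (k l m : F) (f g h : A) (n r : nat).

(** The weight lives in the argument [k] rather than in [f]; the result is to be read with weight
    [k + 1]. *)
Definition dy k f : A := - iota k * f - z * d f.

Lemma dyD k f g : dy k (f + g) = dy k f + dy k g.
Proof. by rewrite /dy (derD der_d); ring. Qed.

Lemma dy_mul k l f g : dy (k + l) (f * g) = dy k f * g + f * dy l g.
Proof. by rewrite /dy (derM der_d) rmorphD /=; ring. Qed.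

(** Commutation of the two partial derivatives: the term [- d f] that comes from differentiating [z]
    is exactly the shift of the weight to [k + 1]. *)
Lemma d_dy k f : d (dy k f) = dy (k + 1) (d f).
Proof.
rewrite /dy (derB der_d) !(derM der_d) (derN der_d) dC dz.
by rewrite rmorphD rmorph1 /=; ring.
Qed.

Lemma e_dy k f : e (dy k f) = dy k (e f) - d f.
Proof.
by rewrite /dy (derB der_e) !(derM der_e) (derN der_e) eC ez ed /=; ring.
Qed.

(* [n!] times the [n]-th Moyal coefficient, so that no division is needed. *)
Fixpoint moyal n k l f g : A :=
  if n is n'.+1 then
    moyal n' (k + 1) (l + 1) (d f) (dy l g)
    - moyal n' (k + 1) (l + 1) (dy k f) (d g)
  else f * g.

Lemma moyalDl n k l f f' g :
  moyal n k l (f + f') g = moyal n k l f g + moyal n k l f' g.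
Proof.
elim: n => [|n IHn] /= in k l f f' g *; first by rewrite mulrDl.
by rewrite (derD der_d) dyD !IHn /=; ring.
Qed.

(** Swapping the arguments exchanges [d] and [dy] in the recursion, which costs one sign per step.
    Facts about the right argument are reduced to the left one in this way. *)
Lemma moyal_sym n k l f g : moyal n l k g f = (-1) ^+ n * moyal n k l f g.
Proof.
elim: n => [|n IHn] /= in k l f g *; first by rewrite mul1r mulrC.
by rewrite !(IHn (k + 1)) exprS; ring.
Qed.

Lemma moyalDr n k l f g g' :
  moyal n k l f (g + g') = moyal n k l f g + moyal n k l f g'.
Proof. by rewrite !(moyal_sym n l k) moyalDl mulrDr. Qed.

Lemma moyal0l n k l g : moyal n k l 0 g = 0.
Proof. by apply: (addrI (moyal n k l 0 g)); rewrite -moyalDl !addr0. Qed.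

Lemma moyal0r n k l f : moyal n k l f 0 = 0.
Proof. by rewrite moyal_sym moyal0l mulr0. Qed.

Lemma moyalNl n k l f g : moyal n k l (- f) g = - moyal n k l f g.
Proof.
by apply: (addrI (moyal n k l f g)); rewrite -moyalDl !subrr moyal0l.
Qed.

Lemma moyalNr n k l f g : moyal n k l f (- g) = - moyal n k l f g.
Proof. by rewrite !(moyal_sym n l k) moyalNl mulrN. Qed.

Lemma d_moyal n k l f g :
  d (moyal n k l f g)
  = moyal n (k + 1) l (d f) g + moyal n k (l + 1) f (d g).
Proof.
elim: n => [|n IHn] /= in k l f g *; first by rewrite (derM der_d).
by rewrite (derB der_d) !IHn !d_dy; ring.
Qed.

(** Each step of the recursion raises both weights by one, so [moyal n] has weight [k + l + 2n];
    with this weight [dy] obeys the Leibniz rule, since it commutes with [d]. *)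
Lemma dy_moyal n k l f g :
  dy (k + l + n%:R *+ 2) (moyal n k l f g)
  = moyal n (k + 1) l (dy k f) g + moyal n k (l + 1) f (dy l g).
Proof.
elim: n => [|n IHn] /= in k l f g *; first by rewrite mul0rn addr0 dy_mul.
have ->: k + l + n.+1%:R *+ 2 = (k + 1) + (l + 1) + n%:R *+ 2.
  by rewrite -natr1; ring.
have dyB x y y' : dy x (y - y') = dy x y - dy x y'.
  by rewrite /dy (derB der_d); ring.
by rewrite dyB !IHn !d_dy; ring.
Qed.

(** [e] fails to commute with [dy] by the term [- d f] of [e_dy]; the recursion is antisymmetric in
    [d] and [dy], so the terms from the two arguments cancel. *)
Lemma e_moyal n k l f g :
  e (moyal n k l f g) = moyal n k l (e f) g + moyal n k l f (e g).
Proof.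
elim: n => [|n IHn] /= in k l f g *; first by rewrite (derM der_e).
rewrite (derB der_e) !IHn !e_dy !ed !(moyalDl, moyalDr, moyalNl, moyalNr).
by ring.
Qed.

(** This is [n!] times the [n]-th coefficient of the triple product bracketed to the left: the
    binomial compensates for the two unnormalised factors. *)
Definition moyal3 n k l m f g h : A :=
  \sum_(r < n.+1)
    moyal (n - r) (k + l + r%:R *+ 2) m (moyal r k l f g) h *+ 'C(n, r).

(* The Moyal bidifferential operator acts on the three pairs of arguments, as
   [d] and [dy] are derivations for every [moyal n]. *)
Lemma moyal3S n k l m f g h :
  moyal3 n.+1 k l m f g h =
    (moyal3 n (k + 1) (l + 1) m (d f) (dy l g) h
     - moyal3 n (k + 1) (l + 1) m (dy k f) (d g) h)
  + (moyal3 n (k + 1) l (m + 1) (d f) g (dy m h)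
     - moyal3 n (k + 1) l (m + 1) (dy k f) g (d h))
  + (moyal3 n k (l + 1) (m + 1) f (d g) (dy m h)
     - moyal3 n k (l + 1) (m + 1) f (dy l g) (d h)).
Proof.
rewrite /moyal3 -!sumrB -!big_split /=.
(* The extra operator sits either in the inner product, which gives the pair [f], [g], or in the
   outer one, where the Leibniz rules give the pairs involving [h]. *)
rewrite (pascal_sum (fun r s =>
  moyal s (k + l + r%:R *+ 2) m (moyal r k l f g) h)).
apply: eq_bigr => r _; rewrite -!mulrnBl -!mulrnDl; congr (_ *+ _).
rewrite [moyal r.+1 _ _ _ _]/= [moyal (n - r).+1 _ _ _ _]/=.
rewrite d_moyal dy_moyal.
have ->: k + l + r.+1%:R *+ 2 = k + 1 + (l + 1) + r%:R *+ 2.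
  by rewrite -natr1; ring.
have ->: k + 1 + l + r%:R *+ 2 = k + l + r%:R *+ 2 + 1 by ring.
have ->: k + (l + 1) + r%:R *+ 2 = k + l + r%:R *+ 2 + 1 by ring.
by rewrite !(moyalDl, moyalNl); ring.
Qed.

(** The recursion [moyal3S] treats the three pairs alike, and reversal changes the sign of each. The
    bracketing survives only at [n = 0], where the product is that of the commutative ring. *)
Lemma moyal3_rev n k l m f g h :
  moyal3 n k l m f g h = (-1) ^+ n * moyal3 n m l k h g f.
Proof.
elim: n => [|n IHn] in k l m f g h *.
  by rewrite /moyal3 !big_ord1 /= !bin0; ring.
rewrite !moyal3S !(IHn (k + 1) (l + 1) m) !(IHn (k + 1) l) !(IHn k) exprS.
by ring.
Qed.

(** Reversing the three arguments and then swapping those of the inner and of the outer product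
    restores the order with the other bracketing; the signs [(-1) ^+ n], [(-1) ^+ r] and
    [(-1) ^+ (n - r)] cancel. *)
Lemma moyal_assoc n k l m f g h :
  \sum_(r < n.+1)
    moyal (n - r) (k + l + r%:R *+ 2) m (moyal r k l f g) h *+ 'C(n, r)
  = \sum_(r < n.+1)
    moyal (n - r) k (l + m + r%:R *+ 2) f (moyal r l m g h) *+ 'C(n, r).
Proof.
rewrite [LHS]moyal3_rev /moyal3 mulr_sumr; apply: eq_bigr => r _.
have -> : moyal r l m g h = (-1) ^+ r * moyal r m l h g by exact: moyal_sym.
have ->: moyal (n - r) k (l + m + r%:R *+ 2) f ((-1) ^+ r * moyal r m l h g)
  = (-1) ^+ r * moyal (n - r) k (l + m + r%:R *+ 2) f (moyal r m l h g).
  (* Only compatibility with negation is available for [moyal], so the sign is pulled out by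
     parity. *)
  by rewrite -signr_odd; case: (odd r); rewrite ?mulN1r ?mul1r ?moyalNr.
rewrite [in RHS]moyal_sym mulrA -exprD subnKC -1?ltnS // (addrC l).
by rewrite mulrnAr.
Qed.

(** The weight grows at each application, so this is not an [iter] of a fixed map. *)
Fixpoint dy_iter n k f : A :=
  if n is n'.+1 then dy_iter n' (k + 1) (dy k f) else f.

Lemma iter_d_dy n k f : iter n d (dy k f) = dy (k + n%:R) (iter n d f).
Proof.
elim: n => [|n IHn] /=; first by rewrite addr0.
by rewrite IHn d_dy -addrA natr1.
Qed.

(** Since [d] and [dy] commute up to the weight shift, the two halves of the Moyal operator commute
    and its [n]-th power expands by the binomial theorem. *)
Lemma moyalE n k l f g :
  moyal n k l f g
  = \sum_(r < n.+1) ((-1) ^+ (n - r) * dy_iter (n - r) (k + r%:R) (iter r d f)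
        * dy_iter r (l + (n - r)%:R) (iter (n - r) d g)) *+ 'C(n, r).
Proof.
elim: n => [|n IHn] in k l f g *.
  by rewrite big_ord1 /= bin0 expr0 mul1r.
rewrite (pascal_sum (fun r s => (-1) ^+ s * dy_iter s (k + r%:R) (iter r d f)
        * dy_iter r (l + s%:R) (iter s d g))).
rewrite [LHS]/= !IHn -sumrB; apply: eq_bigr => r _.
rewrite -mulrnBl; congr (_ *+ _).
rewrite !iter_d_dy -!iterSr exprS /= -!(addrA _ 1) !(addrC 1) -!natr1.
rewrite -!(addrA _ _ 1).
by ring.
Qed.

End Moyal.

(** * Rankin-Cohen brackets as Moyal coefficients of elements constant in [z] *)

Section RankinCohen.

Variables (F : numClosedFieldType) (R : comNzRingType).
Variables (iota : {rmorphism F -> R}) (D : R -> R).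
Hypothesis derDf : derivation D.
Hypothesis DC : forall x, D (iota x) = 0.

Implicit Types (k l m : F) (f g h : R) (n r : nat).

(** The inverse of [n.+1] in [F] is carried to [R] by [iota], so [R] has no torsion. *)
Lemma mulrn_iota n f g : f *+ n.+1 = g *+ n.+1 -> f = g.
Proof.
move=> /(congr1 (fun u => iota (n.+1%:R^-1) * u)).
rewrite -(mulr_natl f) -(mulr_natl g) -(rmorph_nat iota) !mulrA -rmorphM.
by rewrite mulVf ?pnatr_eq0 // rmorph1 !mul1r.
Qed.

(** The weights are free parameters in [F]: [R] carries no grading here, and a shift such as [c * p]
    is absorbed in [k] and [l]. *)
Definition rc n k l f g : R :=
  \sum_(r < n.+1)
    iota ((-1) ^+ r * gbinom (k + n%:R - 1) (n - r)
                    * gbinom (l + n%:R - 1) r)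
    * (iter r D f * iter (n - r) D g).

Lemma iter_der_lin r x f g :
  iter r D (iota x * f + g) = iota x * iter r D f + iter r D g.
Proof.
elim: r => //= r ->.
by rewrite (derD derDf) (derM derDf) DC mul0r add0r.
Qed.

Lemma rc_linl n k l x f f' g :
  rc n k l (iota x * f + f') g = iota x * rc n k l f g + rc n k l f' g.
Proof.
rewrite /rc mulr_sumr -big_split; apply: eq_bigr => r _ /=.
by rewrite iter_der_lin; ring.
Qed.

Lemma rc_linr n k l x f g g' :
  rc n k l f (iota x * g + g') = iota x * rc n k l f g + rc n k l f g'.
Proof.
rewrite /rc mulr_sumr -big_split; apply: eq_bigr => r _ /=.
by rewrite iter_der_lin; ring.
Qed.

Lemma rc0l n k l g : rc n k l 0 g = 0.
Proof.
have := rc_linl n k l 1 0 0 g; rewrite mulr0 addr0 rmorph1 mul1r.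
by rewrite -[LHS]addr0 => /addrI.
Qed.

Lemma rc0r n k l f : rc n k l f 0 = 0.
Proof.
have := rc_linr n k l 1 f 0 0; rewrite mulr0 addr0 rmorph1 mul1r.
by rewrite -[LHS]addr0 => /addrI.
Qed.

Lemma rcMnl n k l f g r : rc n k l (f *+ r) g = rc n k l f g *+ r.
Proof.
rewrite -(mulr_natl (rc n k l f g)) -(mulr_natl f) -(rmorph_nat iota).
rewrite -[_ * f]addr0.
by rewrite rc_linl rc0l addr0.
Qed.

Lemma rcMnr n k l f g r : rc n k l f (g *+ r) = rc n k l f g *+ r.
Proof.
rewrite -(mulr_natl (rc n k l f g)) -(mulr_natl g) -(rmorph_nat iota).
rewrite -[_ * g]addr0.
by rewrite rc_linr rc0r addr0.
Qed.

(* The extra variable [z = 'X] makes room for the second derivation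
   [- k - z d]; elements of [R] embed as the kernel of [d/dz]. *)
Definition zder (p : {poly R}) : {poly R} := map_poly D p + p^`().

Definition ziota : {rmorphism F -> {poly R}} := polyC \o iota.

Lemma derivation_zder : derivation zder.
Proof.
apply: derivation_add; first exact: derivation_map_poly.
exact: derivation_deriv.
Qed.

Lemma zderC f : zder f%:P = (D f)%:P.
Proof. by rewrite /zder derivC addr0 map_poly_derC. Qed.

Lemma iter_zderC r f : iter r zder f%:P = (iter r D f)%:P.
Proof. by elim: r => //= r ->; rewrite zderC. Qed.

Lemma zderX : zder 'X = 1.
Proof. by rewrite /zder derivX map_poly_derX // add0r. Qed.

Lemma deriv_zder p : (zder p)^`() = zder p^`().
Proof.
rewrite /zder derivD; congr (_ + _); apply/polyP=> i.
by rewrite coef_deriv !coef_map_id0 ?der0 // coef_deriv derMn.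
Qed.

Lemma deriv_eq0 (p : {poly R}) : p^`() = 0 -> p = p.[0]%:P.
Proof.
move=> p'0; apply/polyP=> -[|i]; rewrite coefC horner_coef0 //=.
have /(congr1 (fun q : {poly R} => q`_i)) := p'0.
by rewrite coef_deriv coef0 => p'i; apply: (@mulrn_iota i); rewrite mul0rn.
Qed.

Let moyalC := moyal ziota zder 'X.

(** Evaluation at [z = 0] leaves only [- k] in [dy k], and the weight rises by one each time: a
    rising factorial results. *)
Lemma dy_iter_horner0 n k p :
  (dy_iter ziota zder 'X n k p).[0]
  = iota (\prod_(i < n) - (k + i%:R)) * p.[0].
Proof.
elim: n => [|n IHn] /= in k p *; first by rewrite big_ord0 rmorph1 mul1r.
rewrite IHn /dy !hornerE /= big_ord_recl addr0 rmorphM.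
rewrite rmorphN subr0 [RHS]mulrAC [LHS]mulrC; congr (_ * iota _).
by apply: eq_bigr => i _; rewrite lift0 -natr1; ring.
Qed.

Lemma gbinom_prod n k :
  \prod_(i < n) - (k + i%:R) = (-1) ^+ n * gbinom (k + n%:R - 1) n * (n`!)%:R.
Proof.
rewrite /gbinom -mulrA divfK; last by rewrite pnatr_eq0 -lt0n fact_gt0.
rewrite prodrN card_ord; congr (_ * _).
(* Reading the product backwards turns the rising factorial into the falling one of [gbinom]. *)
rewrite (reindex_inj rev_ord_inj) /=; apply: eq_bigr => i _.
by rewrite natrB // -natr1; ring.
Qed.

(* [d/dz] kills the left-hand side, which may therefore be computed at [z = 0],
   where [dy] is multiplication by [- k]. *)
Lemma moyal_const n k l f g :
  moyalC n k l f%:P g%:P = (rc n k l f g *+ n`!)%:P.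
Proof.
have dX := derivation_zder; have ddz := @derivation_deriv R.
have e0 : (moyalC n k l f%:P g%:P)^`() = 0.
  have eC x : (ziota x)^`() = 0 by exact: derivC.
  have ed p : (zder p)^`() = zder p^`() by exact: deriv_zder.
  rewrite /moyalC (e_moyal dX ddz eC (derivX _) ed) !derivC.
  by rewrite moyal0l ?moyal0r ?addr0 //.
rewrite [LHS]deriv_eq0 //; congr _%:P.
have zC x : zder (ziota x) = 0 by rewrite zderC DC.
rewrite /moyalC (moyalE dX zC zderX).
rewrite horner_sum /rc -sumrMnl; apply: eq_bigr => -[r /= ltrn] _.
rewrite -(rmorph_sign ziota) hornerMn !iter_zderC !hornerM.
rewrite !dy_iter_horner0 !hornerC -![_ * _ *+ _]mulr_natr.
rewrite -(rmorph_nat iota 'C(n, r)) -(rmorph_nat iota n`!).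
rewrite !gbinom_prod -(bin_fact (ltrn : (r <= n)%N)) !natrM.
(* The initial weight [k + r] and the [n - r] applications of [dy] add up, so the upper entry no
   longer depends on [r]; likewise for [l]. *)
have -> : k + r%:R + (n - r)%:R - 1 = k + n%:R - 1 by rewrite natrB //; ring.
have -> : l + (n - r)%:R + r%:R - 1 = l + n%:R - 1 by rewrite natrB //; ring.
(* The sign of [moyalE] equals the one produced by [dy] on the first argument; their product is 1,
   and the [(-1) ^+ r] from the second argument remains. *)
have := sqrr_sign F (n - r); move: ((-1) ^+ (n - r)) => s s2.
rewrite -[RHS]mul1r -(rmorph1 iota) -s2 !rmorphM; ring.
Qed.

(** By [moyal_const] the inner product is again constant in [z], so the same lemma evaluates the
    outer one; Moyal associativity then gives the claim after cancelling [n!]. *)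
Lemma rc_assoc n k l m f g h :
  \sum_(r < n.+1) rc (n - r) (k + l + r%:R *+ 2) m (rc r k l f g) h
  = \sum_(r < n.+1) rc (n - r) k (l + m + r%:R *+ 2) f (rc r l m g h).
Proof.
have zC x : zder (ziota x) = 0 by rewrite zderC DC.
have := moyal_assoc derivation_zder zC zderX n k l m f%:P g%:P h%:P.
under eq_bigr do rewrite -/moyalC !moyal_const rcMnl -polyCMn.
under [RHS]eq_bigr do rewrite -/moyalC !moyal_const rcMnr -polyCMn.
rewrite -!rmorph_sum => /polyC_inj eq_assoc.
(* [mulrn_iota] cancels a successor, so the positive number [n!] enters through its predecessor. *)
apply: (@mulrn_iota n`!.-1); rewrite prednK ?fact_gt0 // -!sumrMnl.
have fact_split (r : 'I_n.+1) : (n`! = r`! * (n - r)`! * 'C(n, r))%N.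
  by rewrite mulnC bin_fact // -ltnS.
under eq_bigr => r _ do rewrite (fact_split r) !mulrnA.
by under [RHS]eq_bigr => r _ do rewrite (fact_split r) !mulrnA.
Qed.

End RankinCohen.

(** * Sums over the coefficients of a polynomial *)

Section PolySum.

Variables (R V : comNzRingType).
Implicit Types (p q : {poly R}) (T : nat -> R -> V).

Definition polysum T p : V := \sum_(i < size p) T i p`_i.

Lemma polysum_widen T p n : (forall i, T i 0 = 0) -> (size p <= n)%N ->
  polysum T p = \sum_(i < n) T i p`_i.
Proof.
move=> T0 le_pn; rewrite /polysum (big_ord_widen n (fun i => T i p`_i)) //.
rewrite big_mkcond; apply: eq_bigr => i _; case: ltnP => // le_pi.
by rewrite nth_default.
Qed.

Lemma polysum0 T : polysum T 0 = 0.
Proof. by rewrite /polysum size_poly0 big_ord0. Qed.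

Lemma polysum_lin T u s p q : (forall i, T i 0 = 0) ->
    (forall i x y, T i (u * x + y) = s * T i x + T i y) ->
  polysum T (u%:P * p + q) = s * polysum T p + polysum T q.
Proof.
move=> T0 Tlin.
(* The three sizes may differ, so all sums are padded to a common length; [T i 0 = 0] makes the
   padding harmless. *)
pose n := maxn (size (u%:P * p + q)) (maxn (size p) (size q)).
rewrite !(@polysum_widen _ _ n) ?leq_max ?leqnn ?orbT //.
rewrite mulr_sumr -big_split; apply: eq_bigr => i _.
by rewrite coefD coefCM Tlin.
Qed.

Lemma polysum_CXn T x n : (forall i, T i 0 = 0) ->
  polysum T (x%:P * 'X^n) = T n x.
Proof.
move=> T0; rewrite (@polysum_widen _ _ n.+1) //; last first.
  apply: leq_trans (size_polyMleq _ _) _.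
  by rewrite size_polyXn addnS /= -[leqRHS]add1n leq_add2r size_polyC_leq1.
rewrite big_ord_recr /= coefCM coefXn eqxx mulr1 big1 ?add0r // => i _.
by rewrite coefCM coefXn ltn_eqF // mulr0.
Qed.

(** The factor [u] collects the powers of outer variables already extracted, so that the lemma can
    be iterated through nested layers. *)
Lemma polysum_horner (g : {rmorphism R -> V}) (h : {rmorphism {poly R} -> V})
    u p : (forall x, h x%:P = g x) ->
  \sum_(i < size p) g p`_i * (h 'X ^+ i * u) = h p * u.
Proof.
move=> hC; rewrite -[in RHS](coefK p) poly_def rmorph_sum mulr_suml.
by apply: eq_bigr => i _; rewrite -mul_polyC rmorphM rmorphXn /= hC mulrA.
Qed.

End PolySum.

(** * Expansion of nested polynomials in monomials *)

Section Monomials.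

Variables (F : numClosedFieldType) (V : comNzRingType).
Variable iota : {rmorphism F -> V}.
Implicit Types (f : J F) (G : nat -> nat -> nat -> nat -> V).

(** A version of [monsumJ] with values in an arbitrary ring over [F]. *)
Definition msum f G : V :=
  \sum_(l < size f) \sum_(k < size f`_l) \sum_(j < size f`_l`_k)
    \sum_(i < size f`_l`_k`_j) iota (coefJ f i j k l) * G i j k l.

Lemma msumE f G :
  msum f G = polysum (fun l => polysum (fun k => polysum (fun j =>
    polysum (fun i x => iota x * G i j k l)))) f.
Proof. by []. Qed.

Lemma iota0_mul u : iota 0 * u = 0.
Proof. by rewrite rmorph0 mul0r. Qed.

Lemma msum_lin x f f' G :
  msum (x%:P%:P%:P%:P * f + f') G = iota x * msum f G + msum f' G.
Proof.
rewrite !msumE.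
apply: polysum_lin => [l|l p q]; first exact: polysum0.
apply: polysum_lin => [k|k {}p {}q]; first exact: polysum0.
apply: polysum_lin => [j|j {}p {}q]; first exact: polysum0.
apply: polysum_lin => [i|i y z]; first exact: iota0_mul.
by rewrite rmorphD rmorphM mulrDl mulrA.
Qed.

Lemma msum_monomial i j k l G :
  msum ((('X^i%:P * 'X^j)%:P * 'X^k)%:P * 'X^l) G = G i j k l.
Proof.
rewrite -['X^i]mul1r msumE.
rewrite polysum_CXn => [|?]; last exact: polysum0.
rewrite polysum_CXn => [|?]; last exact: polysum0.
rewrite polysum_CXn => [|?]; last exact: polysum0.
rewrite polysum_CXn => [|?]; last exact: iota0_mul.
by rewrite rmorph1 mul1r.
Qed.

Lemma eq_msum f G G' : (forall i j k l, G i j k l = G' i j k l) ->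
  msum f G = msum f G'.
Proof. by move=> eqG; do 4 (apply: eq_bigr => ? _); rewrite eqG. Qed.

Lemma msum_linG x f G G' :
  msum f (fun i j k l => iota x * G i j k l + G' i j k l)
  = iota x * msum f G + msum f G'.
Proof.
rewrite /msum; do 4 (rewrite mulr_sumr -big_split; apply: eq_bigr => ? _).
by rewrite mulrDr mulrCA.
Qed.

(** Asking for [Q] only on monomials that occur in [f] is what allows the principle to be
    specialised to homogeneous elements. *)
Lemma msum_ind (Q : V -> Prop) f G :
    Q 0 -> (forall x u v, Q u -> Q v -> Q (iota x * u + v)) ->
    (forall i j k l, coefJ f i j k l != 0 -> Q (G i j k l)) ->
  Q (msum f G).
Proof.
move=> Q0 Qlin QG.
have QD u v : Q u -> Q v -> Q (u + v).
  by rewrite -{2}[u]mul1r -(rmorph1 iota); apply: Qlin.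
rewrite /msum; do 4 (apply: (big_ind Q) => // ? _).
set x := coefJ _ _ _ _ _; have [-> | nz_x] := eqVneq x 0.
  by rewrite iota0_mul.
by rewrite -[_ * _]addr0; apply: Qlin => //; apply: QG.
Qed.

Lemma msum_embM (m : P2 F) G :
  msum (embM m) G
  = \sum_(j < size m) \sum_(i < size m`_j) iota m`_j`_i * G i j 0 0.
Proof.
(* Zero is treated apart because a constant polynomial has size 1 only if the constant is
   nonzero. *)
rewrite /msum /embM /coefJ; have [->|m_neq0] := eqVneq m 0.
  by rewrite !polyC0 !size_poly0 !big_ord0.
rewrite size_polyC polyC_eq0 m_neq0 big_ord1 coefC /=.
rewrite size_polyC m_neq0 big_ord1.
by rewrite !coefC.
Qed.

End Monomials.

(** The variables are expanded one layer at a time from the outermost. When the morphisms are the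
    inclusions into [J] and [h4] is the identity, an element is the sum of its monomials. *)
Lemma msumK (F : numClosedFieldType) (V : comNzRingType)
    (h0 : {rmorphism F -> V}) (h1 : {rmorphism {poly F} -> V})
    (h2 : {rmorphism {poly {poly F}} -> V})
    (h3 : {rmorphism {poly {poly {poly F}}} -> V})
    (h4 : {rmorphism {poly {poly {poly {poly F}}}} -> V}) (f : J F) :
    (forall x, h1 x%:P = h0 x) -> (forall x, h2 x%:P = h1 x) ->
    (forall x, h3 x%:P = h2 x) -> (forall x, h4 x%:P = h3 x) ->
  msum h0 f (fun i j k l => h1 'X ^+ i * h2 'X ^+ j * h3 'X ^+ k * h4 'X ^+ l)
  = h4 f.
Proof.
move=> e1 e2 e3 e4.
rewrite -[RHS]mulr1 -(polysum_horner _ _ e4); apply: eq_bigr => l _.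
rewrite -(polysum_horner _ _ e3); apply: eq_bigr => k _.
rewrite -(polysum_horner _ _ e2); apply: eq_bigr => j _.
rewrite -(polysum_horner _ _ e1); apply: eq_bigr => i _.
by rewrite mulr1 !mulrA.
Qed.

Lemma rc_morph (F : numClosedFieldType) (U V : comNzRingType)
    (h : {rmorphism U -> V}) (iU : {rmorphism F -> U}) (iV : {rmorphism F -> V})
    (DU : U -> U) (DV : V -> V) n k l u v :
    (forall x, h (iU x) = iV x) -> (forall x, DV (h x) = h (DU x)) ->
  rc iV DV n k l (h u) (h v) = h (rc iU DU n k l u v).
Proof.
move=> hi hD; rewrite rmorph_sum; apply: eq_bigr => r _.
have iterD j x : iter j DV (h x) = h (iter j DU x).
  by elim: j => //= j ->.
by rewrite !rmorphM /= !hi !iterD.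
Qed.

(** * Brackets on a bigraded algebra with a monomial basis *)

Section GradedBracket.

Variables (F : numClosedFieldType) (V : comNzRingType).
Variables (iota : {rmorphism F -> V}) (e4 e6 va vb : V).
Variables (coef : V -> nat -> nat -> nat -> nat -> F).
Variables (msumV : V -> (nat -> nat -> nat -> nat -> V) -> V).
Variables (a b c : F) (D : V -> V).

Definition mon i j k l : V := e4 ^+ i * e6 ^+ j * va ^+ k * vb ^+ l.

Definition hom (w : int) (p : nat) (f : V) :=
  forall i j k l, coef f i j k l != 0 -> wtJ i j k = w /\ idxJ k l = p.

Hypothesis coef_lin : forall x f g i j k l,
  coef (iota x * f + g) i j k l = x * coef f i j k l + coef g i j k l.
Hypothesis coef_mon : forall i j k l i' j' k' l',
  coef (mon i j k l) i' j' k' l' != 0 -> [/\ i = i', j = j', k = k' & l = l'].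
Hypothesis msumV_lin : forall x f g G,
  msumV (iota x * f + g) G = iota x * msumV f G + msumV g G.
Hypothesis msumV_linG : forall x f G G',
  msumV f (fun i j k l => iota x * G i j k l + G' i j k l)
  = iota x * msumV f G + msumV f G'.
Hypothesis eq_msumV : forall f G G',
  (forall i j k l, G i j k l = G' i j k l) -> msumV f G = msumV f G'.
Hypothesis msumV_mon : forall i j k l G, msumV (mon i j k l) G = G i j k l.
Hypothesis V_span : forall (Q : V -> Prop) f,
    Q 0 -> (forall x u v, Q u -> Q v -> Q (iota x * u + v)) ->
    (forall i j k l, coef f i j k l != 0 -> Q (mon i j k l)) ->
  Q f.
Hypothesis derV : derivation D.
Hypothesis D_iota : forall x, D (iota x) = 0.
Hypothesis De4 : D e4 = iota (- 3%:R^-1) * e6.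
Hypothesis De6 : D e6 = iota (- 2%:R^-1) * e4 ^+ 2.
Hypothesis Dva : D va = iota a * vb.
Hypothesis Dvb : D vb = iota b * (e4 * va).

Implicit Types (f g h : V) (x : F) (n i j k l p q r : nat) (w v : int).

Lemma V_ind (Q : V -> Prop) f :
    Q 0 -> (forall x f g, Q f -> Q g -> Q (iota x * f + g)) ->
    (forall i j k l, Q (mon i j k l)) -> Q f.
Proof. by move=> Q0 Qlin Qmon; apply: V_span. Qed.

Lemma hom_ind w p (Q : V -> Prop) f :
    Q 0 -> (forall x f g, Q f -> Q g -> Q (iota x * f + g)) ->
    (forall i j k l, wtJ i j k = w -> idxJ k l = p -> Q (mon i j k l)) ->
  hom w p f -> Q f.
Proof.
by move=> Q0 Qlin Qmon hf; apply: V_span => // i j k l /hf[]; apply: Qmon.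
Qed.

Lemma coef0V i j k l : coef 0 i j k l = 0.
Proof.
have := coef_lin 1 0 0 i j k l; rewrite mulr0 addr0 mul1r.
by rewrite -[LHS]addr0 => /addrI.
Qed.

Lemma hom0 w p : hom w p 0.
Proof. by move=> i j k l; rewrite coef0V eqxx. Qed.

Lemma hom_lin w p x f g : hom w p f -> hom w p g -> hom w p (iota x * f + g).
Proof.
move=> hf hg i j k l; rewrite coef_lin.
have [f0|/hf //] := eqVneq (coef f i j k l) 0.
by rewrite f0 mulr0 add0r => /hg.
Qed.

Lemma homD w p f g : hom w p f -> hom w p g -> hom w p (f + g).
Proof. by rewrite -{2}[f]mul1r -(rmorph1 iota); apply: hom_lin. Qed.

Lemma homZ w p x f : hom w p f -> hom w p (iota x * f).
Proof. by move=> hf; rewrite -[_ * _]addr0; apply: hom_lin; last exact: hom0. Qed.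

Lemma hom_mon i j k l : hom (wtJ i j k) (idxJ k l) (mon i j k l).
Proof. by move=> i' j' k' l' /coef_mon[-> -> -> ->]. Qed.

Lemma monM i j k l i' j' k' l' :
  mon i j k l * mon i' j' k' l' = mon (i + i') (j + j') (k + k') (l + l').
Proof. by rewrite /mon !exprD; ring. Qed.

Lemma homM w p v q f g :
  hom w p f -> hom v q g -> hom (w + v) (p + q) (f * g).
Proof.
move=> hf hg; apply: (hom_ind (Q := fun f => hom _ _ (f * g)) _ _ _ hf)
  => [|x f1 f2 h1 h2|i j k l wtw idp].
- by rewrite mul0r; apply: hom0.
- by rewrite mulrDl -mulrA; apply: hom_lin.
apply: (hom_ind (Q := fun g => hom _ _ (_ * g)) _ _ _ hg)
  => [|x f1 f2 h1 h2|i' j' k' l' wtv idq].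
- by rewrite mulr0; apply: hom0.
- by rewrite mulrDr mulrCA; apply: hom_lin.
rewrite monM -wtw -wtv -idp -idq.
have -> : wtJ i j k + wtJ i' j' k' = wtJ (i + i') (j + j') (k + k').
  by rewrite /wtJ; lia.
have -> : (idxJ k l + idxJ k' l')%N = idxJ (k + k') (l + l').
  by rewrite /idxJ; lia.
exact: hom_mon.
Qed.

Lemma hom_eq w p w' p' f : w = w' -> p = p' -> hom w p f -> hom w' p' f.
Proof. by move=> -> ->. Qed.

Lemma hom_mon_eq i j k l w p f :
  f = mon i j k l -> wtJ i j k = w -> idxJ k l = p -> hom w p f.
Proof. by move=> -> <- <-; apply: hom_mon. Qed.

(** The degrees of [f] and [D f] are carried together so that the property passes to products by the
    Leibniz rule, and hence from generators to monomials. *)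
Definition hom_der w p f := hom w p f /\ hom (w + 2) p (D f).

Lemma hom_derM w p v q f g :
  hom_der w p f -> hom_der v q g -> hom_der (w + v) (p + q) (f * g).
Proof.
move=> [hf hDf] [hg hDg]; split; first exact: homM.
rewrite (derM derV); apply: homD.
  by apply: (hom_eq _ erefl (homM hDf hg)); lia.
by apply: (hom_eq _ erefl (homM hf hDg)); lia.
Qed.

Lemma hom_derX w p f n : hom_der w p f -> hom_der (w *+ n) (p * n) (f ^+ n).
Proof.
move=> hf; elim: n => [|n IHn].
  rewrite muln0 mulr0n expr0; split.
    by apply: (@hom_mon_eq 0 0 0 0) => //; rewrite /mon; ring.
  by rewrite -(rmorph1 iota) D_iota; apply: hom0.
by rewrite mulrS mulnS exprS; apply: hom_derM.
Qed.

Lemma hom_der_mon i j k l : hom_der (wtJ i j k) (idxJ k l) (mon i j k l).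
Proof.
have h4 : hom_der 4 0 e4.
  split; first by apply: (@hom_mon_eq 1 0 0 0) => //; rewrite /mon; ring.
  rewrite De4; apply: homZ.
  by apply: (@hom_mon_eq 0 1 0 0) => //; rewrite /mon; ring.
have h6 : hom_der 6 0 e6.
  split; first by apply: (@hom_mon_eq 0 1 0 0) => //; rewrite /mon; ring.
  rewrite De6; apply: homZ.
  by apply: (@hom_mon_eq 2 0 0 0) => //; rewrite /mon; ring.
have hA : hom_der (- 2) 1 va.
  split; first by apply: (@hom_mon_eq 0 0 1 0) => //; rewrite /mon; ring.
  rewrite Dva; apply: homZ.
  by apply: (@hom_mon_eq 0 0 0 1) => //; rewrite /mon; ring.
have hB : hom_der 0 1 vb.
  split; first by apply: (@hom_mon_eq 0 0 0 1) => //; rewrite /mon; ring.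
  rewrite Dvb; apply: homZ.
  by apply: (@hom_mon_eq 1 0 1 0) => //; rewrite /mon; ring.
have := hom_derM (hom_derM (hom_derM (hom_derX i h4) (hom_derX j h6))
  (hom_derX k hA)) (hom_derX l hB).
have -> : 4 *+ i + 6 *+ j + (- 2) *+ k + 0 *+ l = wtJ i j k :> int.
  by rewrite /wtJ !pmulrn !mulrzz; lia.
by have -> : (0 * i + 0 * j + 1 * k + 1 * l)%N = idxJ k l by rewrite /idxJ; lia.
Qed.

Lemma hom_D w p f : hom w p f -> hom (w + 2) p (D f).
Proof.
apply: (hom_ind (Q := fun f => hom _ _ (D f))) => [|x f1 f2 h1 h2|i j k l <- <-].
- by rewrite der0 //; apply: hom0.
- rewrite (derD derV) (derM derV) D_iota mul0r add0r; exact: hom_lin.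
exact: (hom_der_mon i j k l).2.
Qed.

Lemma hom_iterD w p f r : hom w p f -> hom (w + (2 * r)%N%:Z) p (iter r D f).
Proof.
move=> hf; elim: r => [|r IHr]; first by rewrite addr0.
by apply: (hom_eq _ erefl (hom_D IHr)); lia.
Qed.

Lemma hom_rc n x y w p v q f g : hom w p f -> hom v q g ->
  hom (w + v + (2 * n)%N%:Z) (p + q) (rc iota D n x y f g).
Proof.
move=> hf hg; rewrite /rc.
apply: (big_ind (hom _ _)); [exact: hom0 | exact: homD | move=> r _].
have hm := homM (hom_iterD (r := r) hf) (hom_iterD (r := n - r) hg).
apply: homZ; apply: hom_eq hm => //.
have : (r <= n)%N by rewrite -ltnS.
lia.
Qed.

(** The effective weight [k + c p]. It is additive in the bidegree and [D] raises it by 2, as the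
    weights in [rc_assoc] require. *)
Definition jwt w p : F := w%:~R + c * p%:R.

Definition vbracket n f g : V :=
  msumV f (fun i j k l => msumV g (fun i' j' k' l' =>
    rc iota D n (jwt (wtJ i j k) (idxJ k l)) (jwt (wtJ i' j' k') (idxJ k' l'))
       (mon i j k l) (mon i' j' k' l'))).

Lemma vbracket_linl n x f f' g :
  vbracket n (iota x * f + f') g
  = iota x * vbracket n f g + vbracket n f' g.
Proof. exact: msumV_lin. Qed.

Lemma vbracket_linr n x f g g' :
  vbracket n f (iota x * g + g')
  = iota x * vbracket n f g + vbracket n f g'.
Proof.
rewrite /vbracket -msumV_linG; apply: eq_msumV => i j k l.
exact: msumV_lin.
Qed.

Lemma vbracket0l n g : vbracket n 0 g = 0.
Proof.
have := vbracket_linl n 1 0 0 g; rewrite mulr0 addr0 rmorph1 mul1r.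
by rewrite -[LHS]addr0 => /addrI.
Qed.

Lemma vbracket0r n f : vbracket n f 0 = 0.
Proof.
have := vbracket_linr n 1 f 0 0; rewrite mulr0 addr0 rmorph1 mul1r.
by rewrite -[LHS]addr0 => /addrI.
Qed.

(** For fixed weights both sides are bilinear, so monomials of the given bidegrees suffice. This
    makes nested brackets computable, as an inner bracket is homogeneous but in general no
    monomial. *)
Lemma vbracket_hom n w p v q f g : hom w p f -> hom v q g ->
  vbracket n f g = rc iota D n (jwt w p) (jwt v q) f g.
Proof.
move=> hf hg.
apply: (hom_ind (Q := fun f => vbracket n f g = rc iota D n _ _ f g) _ _ _ hf)
  => [|x f1 f2 e1 e2|i j k l wtw idp].
- by rewrite vbracket0l rc0l.
- by rewrite vbracket_linl rc_linl // e1 e2.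
apply: (hom_ind (Q := fun g => vbracket n _ g = rc iota D n _ _ _ g) _ _ _ hg)
  => [|x f1 f2 e1 e2|i' j' k' l' wtv idq].
- by rewrite vbracket0r rc0r.
- by rewrite vbracket_linr rc_linr // e1 e2.
by rewrite /vbracket !msumV_mon wtw wtv idp idq.
Qed.

Lemma hom_vbracket n w p v q f g : hom w p f -> hom v q g ->
  hom (w + v + (2 * n)%N%:Z) (p + q) (vbracket n f g).
Proof.
by move=> hf hg; rewrite (vbracket_hom n hf hg); apply: hom_rc.
Qed.

Lemma vbracket_0 f g : vbracket 0 f g = f * g.
Proof.
elim/V_ind: f => [|x f1 f2 e1 e2|i j k l].
- by rewrite vbracket0l mul0r.
- by rewrite vbracket_linl e1 e2 mulrDl mulrA.
elim/V_ind: g => [|x f1 f2 e1 e2|i' j' k' l'].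
- by rewrite vbracket0r mulr0.
- by rewrite vbracket_linr e1 e2 mulrDr mulrCA.
rewrite (vbracket_hom 0 (@hom_mon i j k l) (@hom_mon i' j' k' l')).
rewrite /rc big_ord1 /= /gbinom !big_ord0 fact0 invr1 !mulr1.
by rewrite rmorph1 mul1r.
Qed.

(** Trilinearity reduces to monomials, where every inner bracket is homogeneous and the identity
    becomes [rc_assoc] for the effective weights. *)
Lemma vbracket_assoc n f g h :
  \sum_(r < n.+1) vbracket (n - r) (vbracket r f g) h
  = \sum_(r < n.+1) vbracket (n - r) f (vbracket r g h).
Proof.
elim/V_ind: f => [|x f1 f2 e1 e2|i j k l].
- by rewrite !big1 // => r _; rewrite !vbracket0l.
- under eq_bigr do rewrite !vbracket_linl.
  under [RHS]eq_bigr do rewrite !vbracket_linl.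
  by rewrite !big_split -!mulr_sumr e1 e2.
elim/V_ind: g => [|x f1 f2 e1 e2|i' j' k' l'].
- by rewrite !big1 // => r _; rewrite ?vbracket0l ?vbracket0r ?vbracket0l.
- under eq_bigr do rewrite vbracket_linr vbracket_linl.
  under [RHS]eq_bigr do rewrite vbracket_linl vbracket_linr.
  by rewrite !big_split -!mulr_sumr e1 e2.
elim/V_ind: h => [|x f1 f2 e1 e2|i2 j2 k2 l2].
- by rewrite !big1 // => r _; rewrite !vbracket0r.
- under eq_bigr do rewrite !vbracket_linr.
  under [RHS]eq_bigr do rewrite !vbracket_linr.
  by rewrite !big_split -!mulr_sumr e1 e2.
have hf := @hom_mon i j k l; have hg := @hom_mon i' j' k' l'.
have hh := @hom_mon i2 j2 k2 l2.
(* The effective weight of the inner bracket is thus the one expected by [rc_assoc]. *)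
have jwtD w p v q r :
    jwt (w + v + (2 * r)%N%:Z) (p + q) = jwt w p + jwt v q + r%:R *+ 2.
  have e2 : (2 * r)%N%:Z%:~R = r%:R *+ 2 :> F.
    by rewrite -pmulrn mulnC natrM mulr_natr.
  by rewrite /jwt natrD !intrD e2; ring.
under eq_bigr => r _ do
  rewrite (vbracket_hom _ (hom_vbracket (n := r) hf hg) hh) jwtD
    (vbracket_hom r hf hg).
rewrite rc_assoc //; apply: eq_bigr => r _.
rewrite (vbracket_hom _ hf (hom_vbracket (n := r) hg hh)) jwtD.
by rewrite (vbracket_hom r hg hh).
Qed.

End GradedBracket.

(** Embedded elements involve only monomials with [k = l = 0]: their index is 0, so [c] drops out
    and the effective weight is the modular weight, while [h] intertwines the derivations. *)
Lemma msum_rc_emb (F : numClosedFieldType) (U V : comNzRingType)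
    (h : {rmorphism U -> V}) (iU : {rmorphism F -> U}) (iV : {rmorphism F -> V})
    (DU : U -> U) (DV : V -> V) (u4 u6 : U) (va vb : V) c n (m m' : P2 F) :
    (forall x, h (iU x) = iV x) -> (forall x, DV (h x) = h (DU x)) ->
  msum iV (embM m) (fun i j k l => msum iV (embM m') (fun i' j' k' l' =>
    rc iV DV n (jwt c (wtJ i j k) (idxJ k l)) (jwt c (wtJ i' j' k') (idxJ k' l'))
      (mon (h u4) (h u6) va vb i j k l) (mon (h u4) (h u6) va vb i' j' k' l')))
  = h (\sum_(j < size m) \sum_(i < size m`_j) iU m`_j`_i *
      \sum_(j' < size m') \sum_(i' < size m'`_j') iU m'`_j'`_i' *
        rc iU DU n (wtM i j)%:R (wtM i' j')%:R
          (u4 ^+ i * u6 ^+ j) (u4 ^+ i' * u6 ^+ j')).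
Proof.
move=> hi hD.
have monE i j : mon (h u4) (h u6) va vb i j 0 0 = h (u4 ^+ i * u6 ^+ j).
  by rewrite /mon !expr0 !mulr1 rmorphM !rmorphXn.
have jwtE i j : jwt c (wtJ i j 0) (idxJ 0 0) = (wtM i j)%:R.
  by rewrite /jwt /wtJ muln0 subr0 mulr0 addr0 -pmulrn.
rewrite msum_embM rmorph_sum; apply: eq_bigr => j _.
rewrite rmorph_sum; apply: eq_bigr => i _.
rewrite rmorphM /= hi; congr (_ * _).
rewrite msum_embM rmorph_sum; apply: eq_bigr => j' _.
rewrite rmorph_sum; apply: eq_bigr => i' _.
rewrite rmorphM /= hi; congr (_ * _).
by rewrite !monE !jwtE (rc_morph (iU := iU) (DU := DU)).
Qed.

(** This is the shape of [Sab] on a modular form, whose derivatives in [A] and [B] vanish. Abstract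
    rings let [ring] work on variables instead of nested polynomials. *)
Lemma rmorph_chain_rule (U V : comNzRingType) (h : {rmorphism U -> V})
    (x y z u v w : U) (p q : V) :
  h x * (h y * h z) + h u * (h v * h w ^+ 2) + 0 * p + 0 * q
  = h (x * (y * z) + u * (v * w ^+ 2)).
Proof. by rewrite rmorphD !rmorphM; ring. Qed.

Lemma chain_rule3 (V : comNzRingType) (x y u z : V) :
  0 * x + 0 * y + 1 * u + 0 * z = u.
Proof. by ring. Qed.

Lemma chain_rule4 (V : comNzRingType) (x y z u : V) :
  0 * x + 0 * y + 0 * z + 1 * u = u.
Proof. by ring. Qed.

(** * The algebra of weak Jacobi forms and the derivation [Sab] *)

Section JacobiForms.

Variables (F : numClosedFieldType) (a b c : F).

(** [embJ], [iotaM] and [iotaJ] are [embM], [cstM] and [cst] bundled as ring morphisms, and are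
    convertible to them. *)
Definition embJ : {rmorphism {poly {poly F}} -> {poly {poly {poly {poly F}}}}} :=
  polyC \o polyC.
Definition iotaM : {rmorphism F -> {poly {poly F}}} := polyC \o polyC.
Definition iotaJ : {rmorphism F -> {poly {poly {poly {poly F}}}}} :=
  embJ \o iotaM.

Lemma derivation_Sab : derivation (Sab a b : J F -> J F).
Proof.
apply: derivation_add; last exact/derivation_mulr/derivation_deriv.
apply: derivation_add.
  apply: derivation_add; apply: derivation_mulr; do 2 apply: derivation_map_poly.
    by apply: derivation_map_poly; apply: derivation_deriv.
  exact: derivation_deriv.
by apply: derivation_mulr; apply: derivation_map_poly; apply: derivation_deriv.
Qed.

(** The first digit names the variable, 0 for [E4], 1 for [E6], 2 for [A]; a second digit names the
    layer to which that derivative is lifted coefficientwise. *)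
Let d1 := derivation_deriv {poly F}.
Let d2 := derivation_deriv {poly {poly F}}.
Let d0 := derivation_deriv F.
Let d01 := derivation_map_poly d0.
Let d02 := derivation_map_poly d01.
Let d12 := derivation_map_poly d1.

(** On polynomials constant in [A] and [B] only the [E4] and [E6] terms of the chain rule survive,
    and these form the Serre derivation. *)
Lemma Sab_emb m : Sab a b (embJ m) = embJ (SerreM m).
Proof.
rewrite /Sab /dE4 /dE6 /dA /dB [embJ _]/(m%:P%:P).
rewrite (map_poly_derC d02) (map_poly_derC d01) (map_poly_derC d12).
rewrite (map_poly_derC d1) (map_poly_derC d2) !derivC.
rewrite polyC0.
exact (rmorph_chain_rule embJ (map_poly (fun p => p^`()) m)
  (iotaM (- 3%:R^-1)) (E6M F) m^`() (iotaM (- 2%:R^-1)) (E4M F)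
  (cst a * Bv F) (cst b * E4 F * Av F)).
Qed.

Lemma Sab_iota x : Sab a b (iotaJ x) = 0.
Proof.
rewrite [iotaJ x]/(embJ (iotaM x)) Sab_emb /SerreM [iotaM x]/(x%:P%:P).
by rewrite (map_poly_derC d0) !derivC !mul0r addr0 rmorph0.
Qed.

Lemma Sab_E4 : Sab a b (E4 F) = iotaJ (- 3%:R^-1) * E6 F.
Proof.
rewrite [E4 F]/(embJ (E4M F)) Sab_emb /SerreM /E4M (map_poly_derC d0) derivC.
by rewrite derivX mul1r mul0r addr0 rmorphM.
Qed.

Lemma Sab_E6 : Sab a b (E6 F) = iotaJ (- 2%:R^-1) * E4 F ^+ 2.
Proof.
rewrite [E6 F]/(embJ (E6M F)) Sab_emb /SerreM /E6M (map_poly_derX d0) derivX.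
by rewrite mul1r mul0r add0r rmorphM rmorphXn.
Qed.

Lemma Sab_A : Sab a b (Av F) = iotaJ a * Bv F.
Proof.
have dE4A : dE4 (Av F) = 0.
  rewrite /dE4 /Av (map_poly_derC d02) (map_poly_derX d01); exact (polyC0 _).
have dE6A : dE6 (Av F) = 0.
  rewrite /dE6 /Av (map_poly_derC d12) (map_poly_derX d1); exact (polyC0 _).
have dAA : dA (Av F) = 1.
  rewrite /dA /Av (map_poly_derC d2) derivX; exact (polyC1 _).
have dBA : dB (Av F) = 0 by exact (derivC _).
rewrite /Sab dE4A dE6A dAA dBA.
exact (chain_rule3 (cst (- 3%:R^-1) * E6 F) (cst (- 2%:R^-1) * E4 F ^+ 2)
  (cst a * Bv F) (cst b * E4 F * Av F)).
Qed.

Lemma Sab_B : Sab a b (Bv F) = iotaJ b * (E4 F * Av F).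
Proof.
have dE4B : dE4 (Bv F) = 0 by exact (map_poly_derX d02).
have dE6B : dE6 (Bv F) = 0 by exact (map_poly_derX d12).
have dAB : dA (Bv F) = 0 by exact (map_poly_derX d2).
have dBB : dB (Bv F) = 1 by exact (derivX _).
rewrite /Sab dE4B dE6B dAB dBB.
have assoc := mulrA (cst b) (E4 F) (Av F).
exact (etrans (chain_rule4 (cst (- 3%:R^-1) * E6 F) (cst (- 2%:R^-1) * E4 F ^+ 2)
  (cst a * Bv F) (cst b * E4 F * Av F)) (esym assoc)).
Qed.

Let J : comNzRingType := {poly {poly {poly {poly F}}}}.
Let monV := mon (E4 F : J) (E6 F) (Av F) (Bv F).

Lemma monVE i j k l :
  monV i j k l = (('X^i%:P * 'X^j)%:P * 'X^k)%:P * 'X^l.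
Proof. by rewrite !rmorphM !rmorphXn. Qed.

Lemma coefJ_lin x (f g : J) i j k l :
  coefJ (iotaJ x * f + g) i j k l = x * coefJ f i j k l + coefJ g i j k l.
Proof. by rewrite /coefJ !(coefD, coefCM). Qed.

Lemma coefJ_mon i j k l i' j' k' l' : coefJ (monV i j k l) i' j' k' l' != 0 ->
  [/\ i = i', j = j', k = k' & l = l'].
Proof.
rewrite monVE /coefJ.
rewrite coefCM coefXn.
case: (l' =P l) => [->|_]; last by rewrite mulr0 !coef0 eqxx.
rewrite mulr1 coefCM coefXn.
case: (k' =P k) => [->|_]; last by rewrite mulr0 !coef0 eqxx.
rewrite mulr1 coefCM coefXn.
case: (j' =P j) => [->|_]; last by rewrite mulr0 !coef0 eqxx.
by rewrite mulr1 coefXn; case: (i' =P i) => [->|_]; last by rewrite eqxx.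
Qed.

Lemma msumJ_lin x (f g : J) G :
  msum (V := J) iotaJ (iotaJ x * f + g) G
  = iotaJ x * msum iotaJ f G + msum iotaJ g G.
Proof. exact: msum_lin. Qed.

Lemma monV_msum i j k l G : msum (V := J) iotaJ (monV i j k l) G = G i j k l.
Proof. by rewrite monVE; apply: msum_monomial. Qed.

Lemma msum_monV f : msum iotaJ f monV = f.
Proof.
pose h1 : {rmorphism {poly F} -> J} := polyC \o (polyC \o polyC).
pose h2 : {rmorphism {poly {poly F}} -> J} := polyC \o polyC.
pose h3 : {rmorphism {poly {poly {poly F}}} -> J} := polyC.
pose h4 : {rmorphism {poly {poly {poly {poly F}}}} -> J} := idfun.
by apply: (msumK (h0 := iotaJ) (h1 := h1) (h2 := h2) (h3 := h3) (h4 := h4)).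
Qed.

Lemma J_span (Q : J -> Prop) (f : J) :
    Q 0 -> (forall x u v, Q u -> Q v -> Q (iotaJ x * u + v)) ->
    (forall i j k l, coefJ f i j k l != 0 -> Q (monV i j k l)) ->
  Q f.
Proof. by move=> Q0 Ql Qm; rewrite -[f]msum_monV; apply: msum_ind. Qed.

(** Conversion suffices: [monsumJ] unfolds to [msum iotaJ], and [brh] to [rc] taken at the effective
    weights. *)
Lemma bracketE n (f g : J) :
  bracket a b c n f g
  = vbracket iotaJ (E4 F : J) (E6 F) (Av F) (Bv F) (msum iotaJ) c (Sab a b) n f g.
Proof. by []. Qed.

Lemma bracket_linl n x (f f' g : J) :
  bracket a b c n (iotaJ x * f + f') g
  = iotaJ x * bracket a b c n f g + bracket a b c n f' g.
Proof.
rewrite !bracketE.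
exact (vbracket_linl (E4 F) (E6 F) (Av F) (Bv F) c (Sab a b) msumJ_lin
  n x f f' g).
Qed.

Lemma bracket_linr n x (f g g' : J) :
  bracket a b c n f (iotaJ x * g + g')
  = iotaJ x * bracket a b c n f g + bracket a b c n f g'.
Proof.
rewrite !bracketE.
exact (vbracket_linr (E4 F) (E6 F) (Av F) (Bv F) c (Sab a b) msumJ_lin
  (@msum_linG F J iotaJ) (@eq_msum F J iotaJ) n x f g g').
Qed.

Lemma bracket_0 (f g : J) : bracket a b c 0 f g = f * g.
Proof.
rewrite bracketE.
exact (vbracket_0 c coefJ_mon msumJ_lin
  (@msum_linG F J iotaJ) (@eq_msum F J iotaJ) monV_msum J_span
  derivation_Sab Sab_iota f g).
Qed.

Lemma bracket_assoc n (f g h : J) :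
  \sum_(r < n.+1) bracket a b c (n - r) (bracket a b c r f g) h
  = \sum_(r < n.+1) bracket a b c (n - r) f (bracket a b c r g h).
Proof.
under eq_bigr do rewrite !bracketE.
under [RHS]eq_bigr do rewrite !bracketE.
exact (vbracket_assoc c coefJ_lin coefJ_mon msumJ_lin
  (@msum_linG F J iotaJ) (@eq_msum F J iotaJ) monV_msum J_span
  derivation_Sab Sab_iota Sab_E4 Sab_E6 Sab_A Sab_B n f g h).
Qed.

Lemma hom_bracket n w v p q (f g : J) : homJ w p f -> homJ v q g ->
  homJ (w + v + (2 * n)%N%:Z) (p + q) (bracket a b c n f g).
Proof.
rewrite bracketE.
exact (@hom_vbracket _ _ _ _ _ _ _ _ _ _ _ c _ coefJ_lin coefJ_mon msumJ_lin
  (@msum_linG F J iotaJ) (@eq_msum F J iotaJ) monV_msum J_span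
  derivation_Sab Sab_iota Sab_E4 Sab_E6 Sab_A Sab_B n w p v q f g).
Qed.

Lemma bracket_emb n (m m' : P2 F) :
  bracket a b c n (embM m) (embM m') = embM (SRC n m m').
Proof.
rewrite bracketE.
exact (msum_rc_emb (h := embJ) (iU := iotaM) (iV := iotaJ) (DU := @SerreM F)
  (E4M F) (E6M F) (Av F) (Bv F) c n m m' (fun=> erefl) Sab_emb).
Qed.

End JacobiForms.

Theorem theorem1 (F : numClosedFieldType) (a b c : F) :
  [/\ formal_deformation (fun n => @bracket F a b c n),
      (forall (k l : int) (p q n : nat), (2 %| k)%Z -> (2 %| l)%Z ->
         forall f g : J F, homJ k p f -> homJ l q g ->
           homJ (k + l + (2 * n)%N%:Z) (p + q)%N (bracket a b c n f g)) &
      (forall n : nat,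
         (forall f g : J F, inM f -> inM g -> inM (bracket a b c n f g)) /\
         (forall m m' : P2 F,
            bracket a b c n (embM m) (embM m') = embM (SRC n m m')))].
Proof.
split.
- split=> [j x f f' g | j x f g g' | f g | n f g h].
  + exact: bracket_linl.
  + exact: bracket_linr.
  + exact: bracket_0.
  + exact: bracket_assoc.
- by move=> k l p q n _ _ f g; apply: hom_bracket.
- move=> n; split=> [_ _ [m ->] [m' ->] | m m']; last exact: bracket_emb.
  by exists (SRC n m m'); apply: bracket_emb.
Qed.
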